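(* Let $A$ be a finite abelian group. For every $u\in V_A$, the character $\chi_u$ of $D_C$ extends canonically to a character of $I_u$ by $$\widehat\chi_u(T,\lambda)=\lambda(u).$$ Every associated factor set on $\mathrm{Sp}(V_A)_u$ is therefore a coboundary. Moreover, for every $\sigma\in\mathrm{Irr}(\mathrm{Sp}(V_A)_u)$, $$\widetilde\Pi(u,\sigma)\simeq\mathrm{Ind}_{I_u}^{C(A)}(\widehat\chi_u\otimes\bar\sigma).$$
   Context: **Setting.** $A$ is a finite abelian group, written additively; $\widehat{A}=\mathrm{Hom}(A,U(1))$; $V_A=A\oplus\widehat{A}$ (written additively); $\widehat{V_A}=\mathrm{Hom}(V_A,U(1))$. Put $\beta_A((a,\chi),(b,\psi))=\chi(b)$ and $\omega_A(u,v)=\beta_A(u,v)\beta_A(v,u)^{-1}$; $\mathrm{Sp}(V_A)=\{T\in\mathrm{Aut}(V_A):\omega_A(Tu,Tv)=\omega_A(u,v)\ \forall u,v\}$. All representations are finite-dimensional over $\mathbb{C}$. **Projective Clifford group.** Let $\mathcal{H}=\mathbb{C}[A]$ with orthonormal basis $|b\rangle$, $b\in A$; for $v=(a,\chi)\in V_A$ let $W_v|b\rangle=\chi(b)|a+b\rangle$; $H(A)=\{zW_v:z\in U(1),v\in V_A\}$ and $C(A)=N_{U(\mathcal{H})}(H(A))/(U(1)\cdot I)$. Throughout, $C(A)$ is identified (by a known isomorphism) with the group of pairs $(T,\lambda)$, $T\in\mathrm{Aut}(V_A)$, $\lambda:V_A\to U(1)$ a function, satisfying $\lambda(u+v)\lambda(u)^{-1}\lambda(v)^{-1}=\beta_A(Tu,Tv)\beta_A(u,v)^{-1}$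 for all $u,v$, with product $(T,\lambda)(S,\mu)=(TS,\lambda^S\mu)$, $\lambda^S(u)=\lambda(Su)$; $(T,\lambda)$ corresponds to the class of any unitary $U$ with $UW_uU^\dagger=\lambda(u)W_{Tu}$ for all $u$. Necessarily $T\in\mathrm{Sp}(V_A)$, and the projection to $\mathrm{Sp}(V_A)$ is onto (known) with kernel $D_C=\{(\mathrm{id},\chi):\chi\in\widehat{V_A}\}$. **Affine symplectic group and functor $\mathcal{F}$.** $\mathrm{ASp}(A)=\{(T,\chi):T\in\mathrm{Sp}(V_A),\chi\in\widehat{V_A}\}$ with $(T,\chi)(S,\psi)=(TS,\chi^S\psi)$, $\chi^S(v)=\chi(Sv)$. For a representation $(U,\pi)$ of $\mathrm{ASp}(A)$ put $U_v=\{\xi\in U:\pi(\mathrm{id},\chi)\xi=\chi(v)\xi\ \forall\chi\in\widehat{V_A}\}$ and $\rho(T)=\pi(T,1)$; then $U=\bigoplus_{v\in V_A}U_v$ and $\rho(T)U_v\subseteq U_{Tv}$. $\mathcal{F}(U)$ is the same vector space with $C(A)$-action $(T,\lambda)\cdot\xi=\lambda(v)\rho(T)\xi$ for $\xi\in U_v$. **Representations.** For $u\in V_A$: $\mathrm{Sp}(V_A)_u=\mathrm{Stab}_{\mathrm{Sp}(V_A)}(u)$, $\mathrm{ASp}(A)_u=\mathrm{Sp}(V_A)_u\ltimes\widehat{V_A}$. For $\sigma\in\mathrm{Irr}(\mathrm{Sp}(V_A)_u)$: $\widetilde\sigma_u(T,\chi)=\chi(u)\sigma(T)$ on $\mathrm{ASp}(A)_u$,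 $\Pi(u,\sigma)=\mathrm{Ind}_{\mathrm{ASp}(A)_u}^{\mathrm{ASp}(A)}(\widetilde\sigma_u)$, $\widetilde\Pi(u,\sigma)=\mathcal{F}(\Pi(u,\sigma))$. **Inertia data.** $\chi_u\in\widehat{D_C}$ is $\chi_u(\mathrm{id},\mu)=\mu(u)$; its inertia subgroup in $C(A)$ is $I_u=\{(T,\lambda)\in C(A):Tu=u\}$. $\bar\sigma$ is the inflation of $\sigma$ along $I_u\to\mathrm{Sp}(V_A)_u$, $(T,\lambda)\mapsto T$. An associated factor set is a map $\alpha_u:\mathrm{Sp}(V_A)_u\times\mathrm{Sp}(V_A)_u\to U(1)$ obtained as follows: choose a normalized set-theoretic section $r:\mathrm{Sp}(V_A)_u\to I_u$, write $r(S)r(T)=c_u(S,T)r(ST)$ with $c_u(S,T)\in D_C$, and put $\alpha_u(S,T)=\chi_u(c_u(S,T))$. It is a coboundary if there is $b:\mathrm{Sp}(V_A)_u\to U(1)$ with $b(S)b(T)=\alpha_u(S,T)b(ST)$ for all $S,T$. *)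

(* Defs.v *)
From HB Require Import structures.
From mathcomp Require Import all_boot all_order all_algebra all_fingroup.
From mathcomp Require Import separable cyclotomic complex reals ring.

Set Implicit Arguments.
Unset Strict Implicit.
Unset Printing Implicit Defensive.

Import Order.TTheory GRing.Theory Num.Theory.
Local Open Scope ring_scope.

HB.instance Definition _ (A B : finZmodType) := GRing.Zmodule.on (A * B)%type.

(* The N-th roots of unity of an algebraically closed field: the types of      *)
(* characters and of Clifford pairs below are finite because their functions   *)
(* take values in such a list.                                                 *)
Section UnityRoots.
Variable F : closedFieldType.

Definition unity_roots (N : nat) : seq F :=
  sval (closed_field_poly_normal ('X^N - 1)).

Lemma mem_unity_roots N (x : F) : (0 < N)%N -> x ^+ N = 1 -> x \in unity_roots N.
Proof.
move=> N0 xN; rewrite /unity_roots; case: closed_field_poly_normal => r /= def_p.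
rewrite -root_prod_XsubC; move: def_p.
rewrite lead_coefDl ?size_polyXn ?size_polyN ?size_poly1 // lead_coefXn scale1r.
by move=> <-; rewrite rootE !hornerE xN subrr.
Qed.

Variables (B : finType) (N : nat).
Definition encode_roots (f : {ffun B -> F}) :
    {ffun B -> 'I_(size (unity_roots N)).+1} :=
  [ffun b => inord (index (f b) (unity_roots N))].
Definition decode_roots (g : {ffun B -> 'I_(size (unity_roots N)).+1}) :
    {ffun B -> F} := [ffun b => nth 0 (unity_roots N) (g b)].

Lemma encode_rootsK (f : {ffun B -> F}) : (0 < N)%N ->
  (forall b, f b ^+ N = 1) -> decode_roots (encode_roots f) = f.
Proof.
move=> N0 fN; apply/ffunP=> b; rewrite !ffunE inordK ?ltnS ?index_size //.
by rewrite nth_index // mem_unity_roots.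
Qed.

End UnityRoots.

(* Hom(B, U(1)), written additively; R[i] is the field of complex numbers. *)
Section Dual.
Variables (R : realType) (B : finZmodType).

Definition unitary_character (chi : {ffun B -> R[i]}) : bool :=
  [forall a, `|chi a| == 1] && [forall a, forall b, chi (a + b) == chi a * chi b].

Record dual := Dual { dual_fun :> {ffun B -> R[i]}; _ : unitary_character dual_fun }.

HB.instance Definition _ := [isSub for dual_fun].
HB.instance Definition _ := [Choice of dual by <:].

Lemma unitary_characterP (chi : {ffun B -> R[i]}) :
  reflect ((forall a, `|chi a| = 1) /\ {morph chi : a b / a + b >-> a * b})
          (unitary_character chi).
Proof.
apply: (iffP andP) => [[/forallP h1 /forallP h2]|[h1 h2]]; split.
- by move=> a; apply/eqP.
- by move=> a b; move/forallP: (h2 a) => /(_ b) /eqP.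
- by apply/forallP=> a; apply/eqP.
- by apply/forallP=> a; apply/forallP=> b; apply/eqP.
Qed.

Lemma dual_norm (chi : dual) a : `|chi a| = 1.
Proof. by case: chi => chi /= /unitary_characterP[]. Qed.

Lemma dualD (chi : dual) : {morph chi : a b / a + b >-> a * b}.
Proof. by case: chi => chi /= /unitary_characterP[]. Qed.

Lemma dual_neq0 (chi : dual) a : chi a != 0.
Proof. by rewrite -normr_eq0 dual_norm oner_eq0. Qed.

Lemma dual0 (chi : dual) : chi 0 = 1.
Proof. by apply: (mulfI (dual_neq0 chi 0)); rewrite -dualD addr0 mulr1. Qed.

Lemma dualN (chi : dual) a : chi (- a) = (chi a)^-1.
Proof.
by apply: (mulfI (dual_neq0 chi a)); rewrite -dualD subrr dual0 divff ?dual_neq0.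
Qed.

Lemma dualMn (chi : dual) a n : chi (a *+ n) = chi a ^+ n.
Proof. by elim: n => [|n IHn]; rewrite ?dual0 // mulrS dualD IHn exprS. Qed.

Lemma zmod_expn (b : B) : b *+ #|B| = 0.
Proof.
have [-> |bn0] := eqVneq b 0; first by rewrite mul0rn.
have E : \sum_(x : B) x = \sum_(x : B) x + b *+ #|B|.
  rewrite [LHS](reindex_inj (addIr b)) big_split /=.
  by rewrite sumr_const.
by apply: (addrI (\sum_(x : B) x)); rewrite -E addr0.
Qed.

Lemma card_zmod_gt0 : (0 < #|B|)%N.
Proof. by apply/card_gt0P; exists 0. Qed.

Lemma dual_root (chi : dual) a : chi a ^+ #|B| = 1.
Proof. by rewrite -dualMn zmod_expn dual0. Qed.

Lemma dual_encodeK :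
  pcancel (fun chi : dual => encode_roots #|B| chi) (fun g => insub (decode_roots g)).
Proof.
move=> chi; rewrite encode_rootsK ?valK //; first exact: card_zmod_gt0.
exact: dual_root.
Qed.
HB.instance Definition _ := Countable.copy dual (pcan_type dual_encodeK).
HB.instance Definition _ : isFinite dual := PCanIsFinite dual_encodeK.

Fact dual_zero_subproof : unitary_character [ffun=> 1].
Proof.
by apply/unitary_characterP; split=> [a|a b]; rewrite !ffunE ?normr1 ?mulr1.
Qed.
Definition dual_zero := Dual dual_zero_subproof.

Fact dual_add_subproof (chi psi : dual) :
  unitary_character [ffun a => chi a * psi a].
Proof.
apply/unitary_characterP; split=> [a|a b]; rewrite !ffunE.
  by rewrite normrM !dual_norm mulr1.
by rewrite !dualD mulrACA.
Qed.
Definition dual_add chi psi := Dual (dual_add_subproof chi psi).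

Fact dual_opp_subproof (chi : dual) : unitary_character [ffun a => (chi a)^-1].
Proof.
apply/unitary_characterP; split=> [a|a b]; rewrite !ffunE.
  by rewrite normfV dual_norm invr1.
by rewrite dualD invfM.
Qed.
Definition dual_opp chi := Dual (dual_opp_subproof chi).

Lemma dualP (chi psi : dual) : (chi =1 psi) -> chi = psi.
Proof. by move=> e; apply/val_inj/ffunP. Qed.

Fact dual_addA : associative dual_add.
Proof. by move=> x y z; apply: dualP => a; rewrite !ffunE mulrA. Qed.
Fact dual_addC : commutative dual_add.
Proof. by move=> x y; apply: dualP => a; rewrite !ffunE mulrC. Qed.
Fact dual_add0 : left_id dual_zero dual_add.
Proof. by move=> x; apply: dualP => a; rewrite !ffunE mul1r. Qed.
Fact dual_addN : left_inverse dual_zero dual_opp dual_add.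
Proof.
by move=> x; apply: dualP => a; rewrite !ffunE mulVf ?dual_neq0.
Qed.
HB.instance Definition _ :=
  GRing.isZmodule.Build dual dual_addA dual_addC dual_add0 dual_addN.

Lemma dual_zeroE a : (0 : dual) a = 1. Proof. by rewrite ffunE. Qed.
Lemma dual_addE (chi psi : dual) a : (chi + psi) a = chi a * psi a.
Proof. by rewrite ffunE. Qed.
Lemma dual_oppE (chi : dual) a : (- chi) a = (chi a)^-1.
Proof. by rewrite ffunE. Qed.

End Dual.


Section Separation.
Variables (R : realType) (B : finZmodType) (n' : nat) (e : 'I_n'.+1 -> B).
Hypothesis e_bij : bijective e.
Local Notation n := n'.+1.

Let shift (b : B) : 'M[R[i]]_n := \matrix_(i, j) (e i + b == e j)%:R.

Let shiftD a b : shift (a + b) = shift a *m shift b.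
Proof.
have [f eK fK] := e_bij.
apply/matrixP=> i k; rewrite !mxE (bigD1 (f (e i + a))) //= !mxE fK eqxx mul1r addrA.
rewrite big1 ?addr0 // => j jN; rewrite !mxE; case: eqP => [E|]; last by rewrite mul0r.
by rewrite E eK eqxx in jN.
Qed.

Let shift0 : shift 0 = 1%:M.
Proof.
by apply/matrixP=> i k; rewrite !mxE addr0 (inj_eq (bij_inj e_bij)).
Qed.

Let shiftMn b k : shift (b *+ k) = shift b ^+ k.
Proof. by elim: k => [|k IHk]; rewrite ?shift0 // mulrS shiftD IHk exprS. Qed.

Let cardB : #|B| = n.
Proof. by rewrite -(bij_eq_card e_bij) card_ord. Qed.

Let zmod_expn' (b : B) : b *+ n = 0.
Proof. by rewrite -cardB zmod_expn. Qed.

Let shift_diag b : exists2 P : 'M_n, P \in unitmx & similar_diag P (shift b).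
Proof.
apply/diagonalizableP.
have E : 'X^n - 1 = \prod_(z <- unity_roots R[i] n) ('X - z%:P).
  rewrite /unity_roots; case: closed_field_poly_normal => r /= ->.
  by rewrite lead_coefDl ?size_polyXn ?size_polyN ?size_poly1 // lead_coefXn scale1r.
exists (unity_roots R[i] n).
  rewrite -(separable_prod_XsubC) -E; apply: separable_Xn_sub_1.
  by rewrite pnatr_eq0.
rewrite -E; apply/mxminpoly_min.
by rewrite rmorphB rmorphXn rmorph1 /= horner_mx_X -shiftMn zmod_expn' shift0 subrr.
Qed.

Lemma dual_separates_aux (v : B) : v != 0 -> exists chi : dual R B, chi v != 1.
Proof.
move=> vN0.
have [P Pu /allP /= Pd] : exists2 P : 'M_n, P \in unitmx &
    all [pred M | similar_diag P M] [seq shift b | b <- enum B].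
  apply/codiagonalizableP; split.
    move=> _ _ /mapP[a _ ->] /mapP[b _ ->].
    by rewrite /comm_mx -!shiftD addrC.
  by move=> _ /mapP[a _ ->]; apply: shift_diag.
have [D DE] : exists D, forall b, D b = P *m shift b *m invmx P.
  by exists (fun b => P *m shift b *m invmx P).
have Ddiag b i j : i != j -> D b i j = 0.
  have /(similar_diagP _ Pu) h := Pd _ (map_f _ (mem_enum B b)).
  by move=> ij; rewrite DE; apply: h.
have DD a b i : D (a + b) i i = D a i i * D b i i.
  have -> : D (a + b) = D a *m D b by rewrite !DE shiftD !mulmxA mulmxKV.
  rewrite mxE (bigD1 i) //= big1 ?addr0 // => j ji.
  by rewrite Ddiag ?mul0r // eq_sym.
have D0 i : D 0 i i = 1 by rewrite DE shift0 mulmx1 mulmxV // mxE eqxx.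
have DX b k i : D (b *+ k) i i = D b i i ^+ k.
  elim: k => [|k IHk]; first by rewrite mulr0n expr0 D0.
  by rewrite mulrS DD IHk exprS.
have Dn b i : `|D b i i| = 1.
  apply/eqP; rewrite -(@pexpr_eq1 _ _ n) //.
  by rewrite -normrX -DX zmod_expn' D0 normr1.
have chiP i : unitary_character [ffun b => D b i i].
  by apply/unitary_characterP; split=> [a|a b]; rewrite !ffunE.
have [i Hi|all1] := pickP (fun i => D v i i != 1).
  by exists (Dual (chiP i)); rewrite ffunE.
have Dv : D v = 1%:M.
  apply/matrixP=> i j; rewrite [RHS]mxE; case: eqP => [<-|/eqP ij].
    by move/(_ i)/negbFE/eqP: all1.
  by rewrite Ddiag.
have Sv : shift v = 1%:M.
  have : invmx P *m D v *m P = 1%:M by rewrite Dv mulmx1 mulVmx.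
  by rewrite DE !mulmxA mulVmx // mul1mx mulmxKV.
case/negP: vN0; move/matrixP/(_ ord0 ord0): Sv; rewrite !mxE eqxx.
case: eqP => [/eqP|_ /eqP]; last by rewrite eq_sym oner_eq0.
by rewrite -[X in _ == X -> _]addr0 (inj_eq (addrI _)).
Qed.
End Separation.

Section Orthogonality.
Variables (R : realType) (B : finZmodType).

Lemma dual_separates (v : B) : v != 0 -> exists chi : dual R B, chi v != 1.
Proof.
case E : #|B| (card_zmod_gt0 B) => [//|n'] _.
apply: (@dual_separates_aux R B n' (fun i => enum_val (cast_ord (esym E) i))).
by apply: bij_comp; [apply: enum_val_bij | exists (cast_ord E) => i; apply: val_inj].
Qed.

Lemma dual_inj_eval (u v : B) : (forall chi : dual R B, chi u = chi v) -> u = v.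
Proof.
move=> h; apply/eqP; rewrite -subr_eq0; apply/negPn/negP => /dual_separates[chi].
by rewrite dualD dualN h divff ?eqxx ?dual_neq0.
Qed.

Lemma sum_dual_eval (v : B) : v != 0 -> \sum_(chi : dual R B) chi v = 0.
Proof.
move=> /dual_separates[psi psi1]; set S := \sum_chi _.
have : psi v * S = S.
  rewrite mulr_sumr [RHS](reindex_inj (addrI psi)).
  by apply: eq_bigr => chi _; rewrite dual_addE.
move/eqP; rewrite -subr_eq0 -{2}[S]mul1r -mulrBl mulf_eq0 subr_eq0.
by rewrite (negPf psi1) => /eqP.
Qed.

Lemma sum_dual_points (chi : dual R B) : chi != 0 -> \sum_(v : B) chi v = 0.
Proof.
move=> chi1; have [u hu] : exists u, chi u != 1.
  apply/existsP; rewrite -negb_forall; apply: contra chi1 => /forallP h.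
  by apply/eqP/dualP => a; rewrite dual_zeroE; apply/eqP.
set S := \sum_v _.
have : chi u * S = S.
  rewrite mulr_sumr [RHS](reindex_inj (addrI u)).
  by apply: eq_bigr => v _; rewrite dualD.
move/eqP; rewrite -subr_eq0 -{2}[S]mul1r -mulrBl mulf_eq0 subr_eq0.
by rewrite (negPf hu) => /eqP.
Qed.

Lemma card_dual : #|{: dual R B}| = #|B|.
Proof.
apply/eqP; rewrite -(eqr_nat R[i]); apply/eqP.
transitivity (\sum_(chi : dual R B) \sum_(v : B) chi v).
  rewrite exchange_big (bigD1 0) //= [X in _ + X]big1 ?addr0; last first.
    by move=> v; apply: sum_dual_eval.
  by under eq_bigr do rewrite dual0; rewrite sumr_const.
rewrite (bigD1 0) //= [X in _ + X]big1 ?addr0; last by move=> v; apply: sum_dual_points.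
by under eq_bigr do rewrite dual_zeroE; rewrite sumr_const.
Qed.

End Orthogonality.

Notation phase_space R A := (A * dual R A)%type.

Section PhaseSpace.
Variables (R : realType) (A : finZmodType).
Local Notation V := (phase_space R A).

Definition beta (u v : V) : R[i] := u.2 v.1.

Definition omega (u v : V) : R[i] := beta u v * (beta v u)^-1.

Lemma beta_norm u v : `|beta u v| = 1.
Proof. exact: dual_norm. Qed.
Lemma beta_neq0 u v : beta u v != 0.
Proof. exact: dual_neq0. Qed.
Lemma betaDl u u' v : beta (u + u') v = beta u v * beta u' v.
Proof. exact: dual_addE. Qed.
Lemma betaDr u v v' : beta u (v + v') = beta u v * beta u v'.
Proof. exact: dualD. Qed.
Lemma beta0r u : beta u 0 = 1.
Proof. exact: dual0. Qed.
Lemma betaMnr u v k : beta u (v *+ k) = beta u v ^+ k.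
Proof. by elim: k => [|k IHk]; rewrite ?beta0r // mulrS betaDr IHk exprS. Qed.
Lemma beta_root u v : beta u v ^+ #|{: V}| = 1.
Proof. by rewrite -betaMnr zmod_expn beta0r. Qed.

Definition perm_additive (T : {perm V}) : bool :=
  [forall u, forall v, T (u + v) == T u + T v].

Lemma perm_additiveP (T : {perm V}) :
  reflect {morph T : u v / u + v} (perm_additive T).
Proof.
apply: (iffP forallP) => [h u v|h u]; first by move/forallP: (h u) => /(_ v)/eqP.
by apply/forallP=> v; apply/eqP.
Qed.

Lemma perm_additive1 : perm_additive 1.
Proof. by apply/perm_additiveP => u v; rewrite !perm1. Qed.
Lemma perm_additiveM (T S : {perm V}) :
  perm_additive T -> perm_additive S -> perm_additive (S * T).
Proof.
move=> /perm_additiveP hT /perm_additiveP hS.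
by apply/perm_additiveP => u v; rewrite !permM hS hT.
Qed.
Lemma perm_additiveV (T : {perm V}) : perm_additive T -> perm_additive T^-1.
Proof.
move=> /perm_additiveP hT; apply/perm_additiveP => u v.
by apply: (perm_inj (s := T)); rewrite hT !permKV.
Qed.

(* Sp(V_A). Its product is the composition S \o T, whereas the product of      *)
(* permutations is the opposite one.                                           *)
Definition preserves_omega (T : {perm V}) : bool :=
  [forall u, forall v, omega (T u) (T v) == omega u v].

Lemma preserves_omegaP (T : {perm V}) :
  reflect (forall u v, omega (T u) (T v) = omega u v) (preserves_omega T).
Proof.
apply: (iffP forallP) => [h u v|h u]; first by move/forallP: (h u) => /(_ v)/eqP.
by apply/forallP=> v; apply/eqP.
Qed.

Definition symplectic (T : {perm V}) : bool := perm_additive T && preserves_omega T.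

Record sp := Sp { sp_perm :> {perm V}; _ : symplectic sp_perm }.
HB.instance Definition _ := [isSub for sp_perm].
HB.instance Definition _ := [Finite of sp by <:].

Lemma spD (T : sp) : {morph T : u v / u + v}.
Proof. by case: T => T /= /andP[/perm_additiveP]. Qed.
Lemma sp_omega (T : sp) u v : omega (T u) (T v) = omega u v.
Proof. by case: T => T /= /andP[_ /preserves_omegaP]. Qed.

Fact sp_one_subproof : symplectic 1.
Proof.
by rewrite /symplectic perm_additive1; apply/preserves_omegaP => u v; rewrite !perm1.
Qed.
Fact sp_mul_subproof (S T : sp) : symplectic (sp_perm T * sp_perm S)%g.
Proof.
case: S T => S /= /andP[aS /preserves_omegaP oS] [T /= /andP[aT /preserves_omegaP oT]].
rewrite /symplectic perm_additiveM //; apply/preserves_omegaP => u v.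
by rewrite !permM oS oT.
Qed.
Fact sp_inv_subproof (T : sp) : symplectic (sp_perm T)^-1%g.
Proof.
case: T => T /= /andP[aT /preserves_omegaP oT].
rewrite /symplectic perm_additiveV //; apply/preserves_omegaP => u v.
by rewrite -oT !permKV.
Qed.
Definition sp_one := Sp sp_one_subproof.
Definition sp_mul (S T : sp) := Sp (sp_mul_subproof S T).
Definition sp_inv (T : sp) := Sp (sp_inv_subproof T).
Fact sp_mulA : associative sp_mul.
Proof. by move=> x y z; apply: val_inj; rewrite /= mulgA. Qed.
Fact sp_mul1 : left_id sp_one sp_mul.
Proof. by move=> x; apply: val_inj; rewrite /= mulg1. Qed.
Fact sp_mulV : left_inverse sp_one sp_inv sp_mul.
Proof. by move=> x; apply: val_inj; rewrite /= mulgV. Qed.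
HB.instance Definition _ := Finite_isGroup.Build sp sp_mulA sp_mul1 sp_mulV.

Lemma sp1E u : (1%g : sp) u = u. Proof. by rewrite perm1. Qed.
Lemma spME (S T : sp) u : (S * T)%g u = S (T u). Proof. by rewrite permM. Qed.

(* chi^S = chi \o S. *)
Fact dual_pull_subproof (chi : dual R V) (S : sp) :
  unitary_character [ffun v => chi (S v)].
Proof.
apply/unitary_characterP; split=> [u|u v]; rewrite !ffunE ?dual_norm //.
by rewrite spD dualD.
Qed.
Definition dual_pull chi S : dual R V := Dual (dual_pull_subproof chi S).

Lemma dual_pullE chi S v : dual_pull chi S v = chi (S v).
Proof. by rewrite ffunE. Qed.

Definition dual_simpl := (dual_pullE, dual_addE, dual_oppE, dual_zeroE).

(* ASp(A). *)
Record asp := Asp { asp_sp : sp; asp_char : dual R V }.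
Definition asp_pair x := (asp_sp x, asp_char x).
Definition pair_asp p := Asp p.1 p.2.
Fact asp_pairK : cancel asp_pair pair_asp. Proof. by case. Qed.
HB.instance Definition _ := Finite.copy asp (can_type asp_pairK).

Definition asp_mul (x y : asp) : asp :=
  Asp (asp_sp x * asp_sp y)%g (dual_pull (asp_char x) (asp_sp y) + asp_char y).
Definition asp_one : asp := Asp 1%g 0.
Definition asp_inv (x : asp) : asp :=
  Asp (asp_sp x)^-1%g (- dual_pull (asp_char x) (asp_sp x)^-1%g).
Fact asp_mulA : associative asp_mul.
Proof.
move=> [S c] [T d] [U e]; rewrite /asp_mul /= mulgA; congr Asp.
by apply: dualP => v; rewrite !dual_simpl spME mulrA.
Qed.
Fact asp_mul1 : left_id asp_one asp_mul.
Proof.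
move=> [S c]; rewrite /asp_mul /= mul1g; congr Asp.
by apply: dualP => v; rewrite !dual_simpl mul1r.
Qed.
Fact asp_mulV : left_inverse asp_one asp_inv asp_mul.
Proof.
move=> [S c]; rewrite /asp_mul /= mulVg; congr Asp.
apply: dualP => v; rewrite !dual_simpl -spME mulVg sp1E mulVf //.
exact: dual_neq0.
Qed.
HB.instance Definition _ := Finite_isGroup.Build asp asp_mulA asp_mul1 asp_mulV.

Lemma aspM S c T d : (Asp S c * Asp T d)%g = Asp (S * T)%g (dual_pull c T + d).
Proof. by []. Qed.
Lemma dual_pull1 c : dual_pull c 1%g = c.
Proof. by apply: dualP => v; rewrite dual_pullE sp1E. Qed.
Lemma dual_pull0 S : dual_pull 0 S = 0.
Proof. by apply: dualP => v; rewrite dual_pullE !dual_zeroE. Qed.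

(* The projective Clifford group as the group of pairs (T, lambda): such a     *)
(* pair stands for the class, modulo scalars, of the unitaries U of C[A] with  *)
(* U W_u U^-1 = lambda(u) W_(T u) for all u, where W_(a,chi)|b> = chi(b)|a+b>. *)
Definition clifford_phase (T : {perm V}) (lam : {ffun V -> R[i]}) : bool :=
  [forall u, `|lam u| == 1] &&
  [forall u, forall v, lam (u + v) * (lam u)^-1 * (lam v)^-1 ==
                       beta (T u) (T v) * (beta u v)^-1].

Definition clifford_pair (p : {perm V} * {ffun V -> R[i]}) : bool :=
  perm_additive p.1 && clifford_phase p.1 p.2.

Lemma clifford_phaseP (T : {perm V}) (lam : {ffun V -> R[i]}) :
  reflect ((forall u, `|lam u| = 1) /\
           (forall u v, lam (u + v) = lam u * lam v * (beta (T u) (T v) / beta u v)))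
          (clifford_phase T lam).
Proof.
apply: (iffP andP) => [[/forallP n1 /forallP c]|[n1 c]].
  have n0 u : lam u != 0 by rewrite -normr_eq0 (eqP (n1 u)) oner_eq0.
  split=> [u|u v]; first exact/eqP.
  move/forallP: (c u) => /(_ v)/eqP <-.
  by field; rewrite !n0.
have n0 u : lam u != 0 by rewrite -normr_eq0 n1 oner_eq0.
split; apply/forallP => u; first exact/eqP.
apply/forallP => v; apply/eqP.
by rewrite c; field; rewrite !n0 beta_neq0.
Qed.

Record clifford := Clifford {
  cliff_val :> {perm V} * {ffun V -> R[i]};
  _ : clifford_pair cliff_val }.
HB.instance Definition _ := [isSub for cliff_val].
HB.instance Definition _ := [Choice of clifford by <:].

Definition cliff_perm (x : clifford) : {perm V} := (cliff_val x).1.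
Definition cliff_phase (x : clifford) : {ffun V -> R[i]} := (cliff_val x).2.

Lemma cliffP (x y : clifford) :
  cliff_perm x =1 cliff_perm y -> cliff_phase x =1 cliff_phase y -> x = y.
Proof.
case: x y => [[T l] /= p] [[S m] /= q] e1 e2; apply: val_inj => /=.
by congr pair; [apply/permP|apply/ffunP].
Qed.

Lemma cliff_permD x : {morph cliff_perm x : u v / u + v}.
Proof. by have /andP[/perm_additiveP] := valP x. Qed.
Lemma cliff_phase_norm x u : `|cliff_phase x u| = 1.
Proof. by have /andP[_ /clifford_phaseP[]] := valP x. Qed.
Lemma cliff_phase_neq0 x u : cliff_phase x u != 0.
Proof. by rewrite -normr_eq0 cliff_phase_norm oner_eq0. Qed.
Lemma cliff_phaseD x u v : cliff_phase x (u + v) =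
  cliff_phase x u * cliff_phase x v *
  (beta (cliff_perm x u) (cliff_perm x v) / beta u v).
Proof. by have /andP[_ /clifford_phaseP[]] := valP x. Qed.

Fact cliff_phase_root x u : cliff_phase x u ^+ (2 * #|{: V}|) = 1.
Proof.
set T := cliff_perm x; set l := cliff_phase x; set g := beta (T u) (T u) / beta u u.
have T0 : T 0 = 0 by apply: (addrI (T 0)); rewrite -cliff_permD !addr0.
have TMn k : T (u *+ k) = T u *+ k.
  elim: k => [|k IHk]; first by rewrite !mulr0n.
  by rewrite !mulrS cliff_permD IHk.
have l0 : l 0 = 1.
  apply: (mulfI (cliff_phase_neq0 x 0)); rewrite mulr1 -[RHS]/(l 0).
  by rewrite -[in RHS](addr0 0) cliff_phaseD -/T -/l T0 !beta0r divr1 mulr1.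
have lMn k : l (u *+ k) = l u ^+ k * g ^+ 'C(k, 2).
  elim: k => [|k IHk]; first by rewrite mulr0n l0 expr0 mul1r.
  rewrite mulrS cliff_phaseD -/T -/l IHk TMn !betaMnr -expr_div_n -/g.
  by rewrite binS bin1 exprD exprS !mulrA.
have gV : g ^+ #|{: V}| = 1 by rewrite expr_div_n !beta_root divr1.
have binE : 'C(2 * #|{: V}|, 2) = (#|{: V}| * (2 * #|{: V}|).-1)%N.
  by rewrite bin2 -mulnA mul2n doubleK.
have := lMn (2 * #|{: V}|)%N.
rewrite binE [g ^+ _]exprM gV expr1n mulr1 => <-.
by rewrite mulnC mulrnA zmod_expn mul0rn l0.
Qed.

Definition clifford_code (x : clifford) :=
  (cliff_perm x, encode_roots (2 * #|{: V}|) (cliff_phase x)).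
Definition clifford_decode
    (p : {perm V} * {ffun V -> 'I_(size (unity_roots R[i] (2 * #|{: V}|))).+1}) :
  option clifford := insub (p.1, decode_roots p.2).
Fact clifford_codeK : pcancel clifford_code clifford_decode.
Proof.
move=> x; rewrite /clifford_decode /= encode_rootsK.
- by rewrite /cliff_perm /cliff_phase -surjective_pairing valK.
- by rewrite muln_gt0 /= card_zmod_gt0.
- by move=> u; apply: cliff_phase_root.
Qed.
HB.instance Definition _ := Countable.copy clifford (pcan_type clifford_codeK).
HB.instance Definition _ : isFinite clifford := PCanIsFinite clifford_codeK.

Fact cliff_one_subproof : clifford_pair (1%g, [ffun=> 1]).
Proof.
rewrite /clifford_pair perm_additive1; apply/clifford_phaseP => /=.
split=> [u|u v]; first by rewrite ffunE normr1.
by rewrite !ffunE !perm1 divff ?beta_neq0 // !mulr1.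
Qed.
Definition cliff_one := Clifford cliff_one_subproof.

Fact cliff_mul_subproof (x y : clifford) :
  clifford_pair ((cliff_perm y * cliff_perm x)%g,
    [ffun u => cliff_phase x (cliff_perm y u) * cliff_phase y u]).
Proof.
apply/andP; split.
  by apply/perm_additiveP => u v; rewrite !permM !cliff_permD.
apply/clifford_phaseP; split=> [u|u v] /=.
  by rewrite ffunE normrM !cliff_phase_norm mulr1.
rewrite !ffunE !permM cliff_permD !cliff_phaseD.
by field; rewrite !beta_neq0.
Qed.
Definition cliff_mul x y := Clifford (cliff_mul_subproof x y).

Fact cliff_inv_subproof (x : clifford) :
  clifford_pair ((cliff_perm x)^-1%g,
    [ffun u => (cliff_phase x ((cliff_perm x)^-1%g u))^-1]).
Proof.
have aV : perm_additive (cliff_perm x)^-1%g.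
  by apply/perm_additiveV/perm_additiveP/cliff_permD.
apply/andP; split=> //; apply/clifford_phaseP; split=> [u|u v] /=.
  by rewrite ffunE normfV cliff_phase_norm invr1.
rewrite !ffunE (perm_additiveP _ aV) cliff_phaseD !permKV.
by rewrite invfM invf_div invfM.
Qed.
Definition cliff_inv x := Clifford (cliff_inv_subproof x).

Fact cliff_mulA : associative cliff_mul.
Proof.
move=> x y z; apply: cliffP => u; first by rewrite !permM.
by rewrite !ffunE permM mulrA.
Qed.
Fact cliff_mul1 : left_id cliff_one cliff_mul.
Proof.
by move=> x; apply: cliffP => u; [rewrite permM perm1 | rewrite !ffunE mul1r].
Qed.
Fact cliff_mulV : left_inverse cliff_one cliff_inv cliff_mul.
Proof.
move=> x; apply: cliffP => u; first by rewrite permM permK perm1.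
by rewrite !ffunE permK mulVf // cliff_phase_neq0.
Qed.
HB.instance Definition _ :=
  Finite_isGroup.Build clifford cliff_mulA cliff_mul1 cliff_mulV.

Lemma cliff_permM x y u :
  cliff_perm (x * y)%g u = cliff_perm x (cliff_perm y u).
Proof. by rewrite permM. Qed.
Lemma cliff_phaseM x y u :
  cliff_phase (x * y)%g u = cliff_phase x (cliff_perm y u) * cliff_phase y u.
Proof. by rewrite ffunE. Qed.
Lemma cliff_perm1 u : cliff_perm 1%g u = u. Proof. by rewrite perm1. Qed.
Lemma cliff_phase1 u : cliff_phase 1%g u = 1. Proof. by rewrite ffunE. Qed.

Fact cliff_symplectic (x : clifford) : symplectic (cliff_perm x).
Proof.
apply/andP; split; first by apply/perm_additiveP/cliff_permD.
apply/preserves_omegaP => u v; rewrite /omega; set T := cliff_perm x.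
have l0 := cliff_phase_neq0 x.
have := cliff_phaseD x u v; rewrite addrC cliff_phaseD -/T [_ u * _ v]mulrC.
move=> E0; have /eqP := mulfI (mulf_neq0 (l0 u) (l0 v)) E0.
rewrite eqr_div ?beta_neq0 // => /eqP E.
by apply/eqP; rewrite eqr_div ?beta_neq0 // -E mulrC.
Qed.
Definition cliff_sp (x : clifford) : sp := Sp (cliff_symplectic x).

Lemma cliff_spE x u : cliff_sp x u = cliff_perm x u. Proof. by []. Qed.
Lemma cliff_sp1 : cliff_sp 1%g = 1%g.
Proof. exact: val_inj. Qed.
Lemma cliff_spM : {morph cliff_sp : x y / (x * y)%g}.
Proof. by move=> x y; apply: val_inj. Qed.

(* The embedding chi |-> (id, chi) of the dual of V_A, with image D_C. *)
Fact cliff_dual_subproof (chi : dual R V) : clifford_pair (1%g, dual_fun chi).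
Proof.
rewrite /clifford_pair perm_additive1; apply/clifford_phaseP => /=.
split=> [u|u v]; first exact: dual_norm.
by rewrite dualD !perm1 divff ?beta_neq0 // mulr1.
Qed.
Definition cliff_dual (chi : dual R V) := Clifford (cliff_dual_subproof chi).

Definition D_C : {set clifford} := [set cliff_dual chi | chi : dual R V].

End PhaseSpace.

(* Finite-dimensional representations of a subgroup G of gT, on vector spaces  *)
(* rather than by matrices as in mxrepresentation, since both induction and    *)
(* the passage from ASp(A) to C(A) act on the underlying spaces. The action is *)
(* on the left: r x is only meaningful for x in G.                             *)
Section Representations.
Variable F : numFieldType.

Section Defs.
Variables (gT : finGroupType) (G : {set gT}).

Definition is_linrep (V : vectType F) (r : gT -> 'End(V)) : Prop :=
  r 1%g = \1%VF /\ {in G &, forall x y, r (x * y)%g = (r x \o r y)%VF}.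

Record linrep (V : vectType F) :=
  LinRep { linrep_fun :> gT -> 'End(V); linrepP : is_linrep linrep_fun }.

Definition linrep_irreducible (V : vectType F) (r : linrep V) : Prop :=
  fullv != 0%VS :> {vspace V} /\
  forall U : {vspace V},
    {in G, forall x, (r x @: U <= U)%VS} -> U = 0%VS \/ U = fullv.

Definition linrep_iso (V W : vectType F) (r : linrep V) (s : linrep W) : Prop :=
  exists f : 'Hom(V, W),
    [/\ lker f = 0%VS, limg f = fullv
      & {in G, forall x, (f \o r x)%VF = (s x \o f)%VF}].

(* Homomorphisms from G to U(1), U(1) being the elements of norm 1. *)
Definition linear_char (f : gT -> F) : Prop :=
  {in G, forall x, `|f x| = 1} /\ {in G &, {morph f : x y / (x * y)%g >-> x * y}}.

End Defs.

Section Twist.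
Variables (gT : finGroupType) (G : {group gT}) (f : gT -> F).
Variables (f_char : linear_char G f) (V : vectType F) (r : linrep G V).

Fact twist_subproof : is_linrep G (fun x => f x *: r x).
Proof.
have [[f1 fM] [r1 rM]] := (f_char, linrepP r).
split=> [|x y Gx Gy]; last by rewrite fM // rM // -comp_lfunZl -comp_lfunZr scalerA.
have fn0 : f 1%g != 0 by rewrite -normr_eq0 f1 // oner_eq0.
suff -> : f 1%g = 1 by rewrite r1 scale1r.
by apply: (mulfI fn0); rewrite -fM // mulg1 mulr1.
Qed.
(* The tensor product of the one-dimensional representation f and r, realised  *)
(* on the space of r.                                                          *)
Definition twist : linrep G V := LinRep twist_subproof.
End Twist.

Section Pullback.
Variables (gT hT : finGroupType) (G : {set gT}) (H : {set hT}) (f : gT -> hT).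
Hypotheses (f1 : f 1%g = 1%g)
           (fM : {in G &, {morph f : x y / (x * y)%g >-> (x * y)%g}})
           (fGH : {in G, forall x, f x \in H}).
Variables (V : vectType F) (r : linrep H V).

Fact pullback_subproof : is_linrep G (fun x => r (f x)).
Proof.
have [r1 rM] := linrepP r; split=> [|x y Gx Gy]; first by rewrite f1.
by rewrite fM // rM ?fGH.
Qed.
Definition pullback : linrep G V := LinRep pullback_subproof.
End Pullback.

(* Ind_H^gT r: functions f : gT -> V with f (h x) = r h (f x) for h in H,      *)
(* acted on by right translation.                                              *)
Section Induction.
Variables (gT : finGroupType) (H : {group gT}) (V : vectType F) (r : linrep H V).

Definition equivariance_defect (hx : gT * gT) (f : {ffun gT -> V}) : V :=
  f (hx.1 * hx.2)%g - r hx.1 (f hx.2).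

Fact equivariance_defect_linear hx : linear (equivariance_defect hx).
Proof.
move=> a f g; rewrite /equivariance_defect !ffunE linearP /= scalerBr.
by rewrite opprD addrACA.
Qed.
HB.instance Definition _ hx := GRing.isLinear.Build F {ffun gT -> V} V _
  (equivariance_defect hx) (equivariance_defect_linear hx).

Definition ind_space : {vspace {ffun gT -> V}} :=
  (\bigcap_(hx : gT * gT | hx.1 \in H) lker (linfun (equivariance_defect hx)))%VS.

Lemma ind_spaceP (f : {ffun gT -> V}) :
  reflect {in H, forall h x, f (h * x)%g = r h (f x)} (f \in ind_space).
Proof.
apply: (iffP subv_bigcapP) => [h_f h Hh x|h_f [h x] /= Hh].
  have := h_f (h, x) Hh; rewrite -memvE memv_ker lfunE /= subr_eq0.
  by move/eqP.
by rewrite -memvE memv_ker lfunE /= subr_eq0; apply/eqP/h_f.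
Qed.

Definition right_translate (g : gT) (f : {ffun gT -> V}) : {ffun gT -> V} :=
  [ffun x => f (x * g)%g].

Fact right_translate_mem g (f : subvs_of ind_space) :
  right_translate g (vsval f) \in ind_space.
Proof.
apply/ind_spaceP => h Hh x; rewrite !ffunE -mulgA.
by have /ind_spaceP -> := subvsP f.
Qed.

Definition ind_act (g : gT) (f : subvs_of ind_space) : subvs_of ind_space :=
  Subvs (right_translate_mem g f).

Fact ind_act_linear g : linear (ind_act g).
Proof.
by move=> a f f'; apply: val_inj; apply/ffunP=> x; rewrite /= !ffunE.
Qed.
HB.instance Definition _ g :=
  GRing.isLinear.Build F (subvs_of ind_space) (subvs_of ind_space) _
    (ind_act g) (ind_act_linear g).

Fact ind_subproof : is_linrep [set: gT] (fun g => linfun (ind_act g)).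
Proof.
split=> [|g g' _ _]; apply/lfunP=> f.
  rewrite !lfunE; apply: val_inj; apply/ffunP=> x.
  by rewrite ffunE mulg1.
rewrite comp_lfunE !lfunE; apply: val_inj; apply/ffunP=> x.
by rewrite !ffunE mulgA.
Qed.
Definition ind : linrep [set: gT] (subvs_of ind_space) := LinRep ind_subproof.

Lemma indE g (f : subvs_of ind_space) x : vsval (ind g f) x = vsval f (x * g)%g.
Proof. by rewrite /= lfunE ffunE. Qed.
End Induction.
End Representations.

(* The functor F on objects, from representations of ASp(A) to representations *)
(* of C(A) on the same space.                                                  *)
Section Functor.
Variables (R : realType) (A : finZmodType).
Local Notation V := (phase_space R A).
Variables (U : vectType R[i]) (pi : linrep [set: asp R A] U).

Definition weight_space (v : V) : {vspace U} :=
  (\bigcap_(chi : dual R V) lker (pi (Asp 1%g chi) - chi v *: \1%VF)%R)%VS.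

Definition sp_action (T : sp R A) : 'End(U) := pi (Asp T 0).

Lemma weight_spaceP (v : V) (xi : U) :
  reflect (forall chi : dual R V, pi (Asp 1%g chi) xi = chi v *: xi)
          (xi \in weight_space v).
Proof.
apply: (iffP subv_bigcapP) => [h chi|h chi _]; last first.
  by rewrite -memvE; apply/eqlfunP; rewrite scale_lfunE id_lfunE.
by have /eqlfunP := h chi isT; rewrite scale_lfunE id_lfunE.
Qed.

Lemma pi_mul x y xi : pi (x * y)%g xi = pi x (pi y xi).
Proof. by have [_ ->] := linrepP pi; rewrite ?inE // comp_lfunE. Qed.
Lemma pi_one xi : pi 1%g xi = xi.
Proof. by have [-> _] := linrepP pi; rewrite id_lfunE. Qed.

Lemma sp_action_weight T v xi :
  xi \in weight_space v -> sp_action T xi \in weight_space (T v).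
Proof.
move=> /weight_spaceP h; apply/weight_spaceP => chi.
have -> : chi (T v) *: sp_action T xi = sp_action T (pi (Asp 1%g (dual_pull chi T)) xi).
  by rewrite h linearZ /= dual_pullE.
by rewrite /sp_action -!pi_mul !aspM mulg1 mul1g dual_pull0 addr0 add0r.
Qed.

Let card0 : #|{: V}|%:R != 0 :> R[i].
Proof. by rewrite pnatr_eq0 -lt0n card_zmod_gt0. Qed.

Let avg (v : V) (xi : U) : U :=
  #|{: V}|%:R^-1 *: \sum_(chi : dual R V) (chi v)^-1 *: pi (Asp 1%g chi) xi.

Let dual_actM (chi psi : dual R V) xi :
  pi (Asp 1%g chi) (pi (Asp 1%g psi) xi) = pi (Asp 1%g (chi + psi)) xi.
Proof.
by rewrite -pi_mul aspM mulg1 dual_pull1.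
Qed.

Let avg_mem v xi : avg v xi \in weight_space v.
Proof.
apply/weight_spaceP => psi; rewrite /avg linearZ linear_sum /= scalerA mulrC -scalerA.
congr (_ *: _); rewrite scaler_sumr [RHS](reindex_inj (addrI psi)) /=.
apply: eq_bigr => chi _; rewrite linearZ /= dual_actM scalerA dual_addE invfM.
by rewrite mulrA divff ?dual_neq0 // mul1r.
Qed.

Let avg_sum xi : \sum_v avg v xi = xi.
Proof.
rewrite /avg -scaler_sumr exchange_big (bigD1 0) //= [X in _ + X]big1 ?addr0.
  under eq_bigr do rewrite dual_zeroE invr1 scale1r.
  by rewrite sumr_const -[pi _ _ *+ _]scaler_nat scalerA mulVf // scale1r pi_one.
move=> chi chi0; rewrite -scaler_suml.
under eq_bigr do rewrite -dual_oppE.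
by rewrite sum_dual_points ?scale0r // oppr_eq0.
Qed.

Lemma weight_space_total : (\sum_v weight_space v)%VS = fullv.
Proof.
apply/eqP; rewrite eqEsubv subvf; apply/subvP => xi _; rewrite -(avg_sum xi).
by apply: memv_sumr => v _; apply: avg_mem.
Qed.

Lemma weight_space_direct : directv (\sum_v weight_space v).
Proof.
apply/directv_sum_independent => us us_mem us0 w _.
have : avg w (\sum_v us v) = us w; last by move<-; rewrite us0 /avg;
  rewrite big1 ?scaler0 // => chi _; rewrite linear0 scaler0.
have E (chi : dual R V) : (chi w)^-1 *: pi (Asp 1%g chi) (\sum_v us v) =
             \sum_v chi (v - w) *: us v.
  rewrite linear_sum scaler_sumr; apply: eq_bigr => v _ /=.
  by have /weight_spaceP -> := us_mem v isT; rewrite scalerA dualD dualN mulrC.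
rewrite /avg; under eq_bigr do rewrite E; rewrite exchange_big (bigD1 w) //=.
rewrite [X in _ + X]big1 ?addr0.
  under eq_bigr do rewrite subrr dual0 scale1r.
  by rewrite sumr_const -[us w *+ _]scaler_nat card_dual scalerA mulVf // scale1r.
by move=> v vw; rewrite -scaler_suml sum_dual_eval ?scale0r // subr_eq0.
Qed.

(* The projection onto weight_space v along the other weight spaces. *)
Definition weight_proj (v : V) : 'End(U) :=
  sumv_pi (\sum_v weight_space v)%VS v.

Lemma weight_proj_id v w xi :
  xi \in weight_space v -> weight_proj w xi = if w == v then xi else 0.
Proof.
move=> xi_v; have /directv_sum_unique dir := weight_space_direct.
pose us w := weight_proj w xi; pose vs w : U := if w == v then xi else 0.
have us_mem i : true -> us i \in weight_space i by move=> _; apply: memv_sum_pi.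
have vs_mem i : true -> vs i \in weight_space i.
  by move=> _; rewrite /vs; case: eqP => [->|_]; rewrite ?mem0v.
have us_sum : \sum_w us w = xi.
  by rewrite /us /weight_proj sumv_pi_sum // weight_space_total memvf.
have vs_sum : \sum_w vs w = xi by rewrite /vs -big_mkcond big_pred1_eq.
have := dir us vs us_mem vs_mem; rewrite us_sum vs_sum eqxx => /esym/forallP h.
exact/eqP/h.
Qed.

(* (T, lambda) acts on weight_space v as lambda(v) rho(T): see functor_actE. *)
Definition functor_act (x : clifford R A) : 'End(U) :=
  \sum_(v : V) cliff_phase x v *: (sp_action (cliff_sp x) \o weight_proj v)%VF.

Lemma functor_actE x v xi : xi \in weight_space v ->
  functor_act x xi = cliff_phase x v *: sp_action (cliff_sp x) xi.
Proof.
move=> xi_v; rewrite sum_lfunE (bigD1 v) //= big1 ?addr0.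
  by rewrite scale_lfunE comp_lfunE (weight_proj_id _ xi_v) eqxx.
move=> w wv; rewrite scale_lfunE comp_lfunE (weight_proj_id _ xi_v) (negPf wv).
by rewrite linear0 scaler0.
Qed.

Lemma weight_space_ext (f g : 'End(U)) :
  (forall v, {in weight_space v, f =1 g}) -> f = g.
Proof.
move=> fg; apply/lfunP=> xi; rewrite -(avg_sum xi) !linear_sum.
by apply: eq_bigr => v _; apply: fg (avg_mem v xi).
Qed.

Fact functor_subproof : is_linrep [set: clifford R A] functor_act.
Proof.
split=> [|x y _ _]; apply: weight_space_ext => v xi xi_v.
  rewrite (functor_actE _ xi_v) cliff_phase1 scale1r cliff_sp1 id_lfunE.
  exact: pi_one.
rewrite comp_lfunE !(functor_actE _ xi_v) linearZ /=.
rewrite (functor_actE _ (sp_action_weight _ xi_v)) scalerA cliff_phaseM.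
rewrite [in RHS]mulrC cliff_spE cliff_spM; congr (_ *: _).
by rewrite /sp_action -pi_mul aspM dual_pull0 addr0.
Qed.
Definition functor : linrep [set: clifford R A] U := LinRep functor_subproof.

End Functor.

Section Inertia.
Variables (R : realType) (A : finZmodType) (u : phase_space R A).
Local Notation V := (phase_space R A).

Definition sp_stab : {set sp R A} := [set T : sp R A | T u == u].
Definition asp_stab : {set asp R A} := [set x : asp R A | asp_sp x \in sp_stab].
Definition inertia : {set clifford R A} := [set x : clifford R A | cliff_perm x u == u].

Fact sp_stab_group_set : group_set sp_stab.
Proof.
apply/group_setP; split=> [|S T]; rewrite !inE ?sp1E //.
by move=> /eqP Su /eqP Tu; rewrite spME Tu Su.
Qed.
Canonical sp_stab_group := Group sp_stab_group_set.

Fact asp_stab_group_set : group_set asp_stab.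
Proof.
by apply/group_setP; split=> [|x y]; rewrite !inE ?sp1E // spME => /eqP xu /eqP ->; apply/eqP.
Qed.
Canonical asp_stab_group := Group asp_stab_group_set.

Fact inertia_group_set : group_set inertia.
Proof.
apply/group_setP; split=> [|x y]; rewrite !inE ?cliff_perm1 //.
by move=> /eqP xu /eqP yu; rewrite cliff_permM yu xu.
Qed.
Canonical inertia_group := Group inertia_group_set.

(* chi_u(id, mu) = mu(u), where mu stands for (id, mu) = cliff_dual mu. *)
Definition chi_u (mu : dual R V) : R[i] := mu u.

Definition chi_hat (x : clifford R A) : R[i] := cliff_phase x u.

Fact chi_hat_linear_char : linear_char inertia chi_hat.
Proof.
split=> [x _|x y _]; first exact: cliff_phase_norm.
by rewrite inE => /eqP yu; rewrite /chi_hat cliff_phaseM yu.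
Qed.

Definition asp_weight_char (x : asp R A) : R[i] := asp_char x u.

Fact asp_weight_linear_char : linear_char asp_stab asp_weight_char.
Proof.
split=> [x _|x y _]; first exact: dual_norm.
by rewrite !inE => /eqP yu; rewrite /asp_weight_char !dual_simpl yu.
Qed.

Fact asp_sp_stab : {in asp_stab, forall x, asp_sp x \in sp_stab}.
Proof. by move=> x; rewrite inE. Qed.
Fact cliff_sp_stab : {in inertia, forall x, cliff_sp x \in sp_stab}.
Proof. by move=> x; rewrite !inE. Qed.

Section Sigma.
Variables (W : vectType R[i]) (sigma : linrep sp_stab W).

(* (T, chi) |-> chi(u) sigma(T), and its induction Pi(u, sigma). *)
Definition asp_sigma : linrep asp_stab W :=
  twist asp_weight_linear_char
    (pullback erefl (in2W (fun _ _ => erefl)) asp_sp_stab sigma).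
Definition Pi := ind asp_sigma.
Definition Pi_tilde := functor Pi.

Definition inflation : linrep inertia W :=
  pullback (@cliff_sp1 R A) (in2W (@cliff_spM R A)) cliff_sp_stab sigma.

Definition chi_hat_tensor : linrep inertia W := twist chi_hat_linear_char inflation.
End Sigma.

Definition associated_factor_set (alpha : sp R A -> sp R A -> R[i]) : Prop :=
  exists (r : sp R A -> clifford R A) (c : sp R A -> sp R A -> dual R V),
    [/\ r 1%g = 1%g,
        {in sp_stab, forall T, r T \in inertia /\ cliff_sp (r T) = T},
        {in sp_stab &, forall S T,
           (r S * r T = cliff_dual (c S T) * r (S * T))%g}
      & {in sp_stab &, forall S T, alpha S T = chi_u (c S T)}].

Definition coboundary (alpha : sp R A -> sp R A -> R[i]) : Prop :=
  exists b : sp R A -> R[i],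
    {in sp_stab, forall T, `|b T| = 1} /\
    {in sp_stab &, forall S T, b S * b T = alpha S T * b (S * T)%g}.

End Inertia.

(* Main.v *)
Require Import Defs.
From HB Require Import structures.
From mathcomp Require Import all_boot all_order all_algebra all_fingroup.
From mathcomp Require Import complex reals.
From mathcomp Require Import spectral ring.

Set Implicit Arguments.
Unset Strict Implicit.
Unset Printing Implicit Defensive.

Import GRing.Theory Num.Theory.
Local Open Scope ring_scope.

(** The phase at a fixed point of the action is multiplicative: for x and y in
    the inertia group of u, the product rule for phases reads
    lambda_x(T_y u) lambda_y(u) with T_y u = u. Hence chi_hat is a character of
    the inertia group, and evaluating it along a section r trivialises the factor
    set: b(T) = chi_hat (r T).

    For the isomorphism, the induced space Pi of ASp(A) consists of W-valued
    functions f on ASp(A), and the translations (id, chi) act on the value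
    f(T, 0) through the character chi |-> chi(T^-1 u). So evaluation at (T, 0)
    only sees the component of f of weight T^-1 u (Pi_weight_eval), and
    evaluation at 1 is a map from Pi_tilde to W that intertwines the inertia
    group with chi_hat (x) inflated sigma. Frobenius reciprocity turns it into
    f |-> (x |-> (x . f)(1)), which takes the explicit form
      f |-> (x = (T, lambda) |-> lambda(T^-1 u) f(T, 0))
    (Pi_tilde_eval1).

    This map is invertible because every symplectic T is the first component of
    some Clifford pair (cliff_sp_onto): f is determined by its values at the
    points (T, 0), which can be read off at any lift of T and prescribed
    through it. Surjectivity onto Sp comes down to the fact that the symmetric
    2-cocycle beta(Tu, Tv) / beta(u, v) is a coboundary, that is, that a
    finite abelian group has no nontrivial abelian extension by U(1); here it is
    obtained from a common eigenvector of the twisted translation operators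
    (symmetric_cocycle_splits). *)

(** * Splitting of symmetric cocycles *)

(** On functions on B, the operators S v, translation by v twisted by c(-, v),
    satisfy S u S v = c(u, v) S (u + v). The symmetry of c makes them commute, so
    they have a common eigenvector, and its eigenvalues are the wanted phases. *)
Lemma symmetric_cocycle_splits (C : numClosedFieldType) (B : finZmodType)
    (c : B -> B -> C) :
  (forall u v, `|c u v| = 1) -> (forall u v, c u v = c v u) ->
  (forall u v w, c u v * c (u + v) w = c v w * c u (v + w)) ->
  exists lam : B -> C, (forall u, `|lam u| = 1) /\
    (forall u v, lam u * lam v = c u v * lam (u + v)).
Proof.
move=> c_norm c_sym c_coc.
(* Functions on B are row vectors, the coordinates being numbered by enum_rank. *)
pose S v : 'M[C]_#|B| := \matrix_(i, j)
  (c (enum_val i) v * (enum_val i + v == enum_val j)%:R).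
have mulS n (x : 'M_(n, _)) v i b :
    (x *m S v) i (enum_rank (b + v)) = x i (enum_rank b) * c b v.
  rewrite mxE (bigD1 (enum_rank b)) //= !mxE !enum_rankK eqxx mulr1.
  rewrite big1 ?addr0 // => j jb; rewrite mxE enum_rankK (inj_eq (addIr v)).
  case: eqP => [bE|_]; last by rewrite !mulr0.
  by rewrite -bE enum_valK eqxx in jb.
have SM u v : S u *m S v = c u v *: S (u + v).
  apply/matrixP=> i k; rewrite -[k]enum_valK; set b := enum_val k.
  rewrite -[b](subrK v) mulS !mxE !enum_rankK subrK.
  have -> : (enum_val i + u == b - v) = (enum_val i + (u + v) == b).
    by rewrite addrA -(inj_eq (addIr v)) subrK.
  case: eqP => [bE|_]; last by rewrite !mulr0 mul0r.
  by rewrite !mulr1 -bE addrA addrK c_coc.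
have [|_ _ /mapP[u _ ->] /mapP[v _ ->]|x x_neq0 x_stable] :=
  @common_eigenvector C #|B| [seq S v | v <- enum B].
- exact: card_zmod_gt0.
- by rewrite /comm_mx !SM c_sym addrC.
have /fin_all_exists [lam lamP] : forall v, exists a, x *m S v = a *: x.
  move=> v; apply/sub_rVP/(allP x_stable)/map_f; exact: mem_enum.
pose y b := x 0 (enum_rank b).
have lamE b v : y b * c b v = lam v * y (b + v).
  by rewrite -mulS lamP mxE.
have [b0 yb0] : exists b, y b != 0.
  apply/existsP; rewrite -negb_forall; apply: contra x_neq0 => /forallP y0.
  by apply/eqP/rowP => k; rewrite mxE -[k]enum_valK; apply/eqP/y0.
exists lam; split=> [v|u v].
  (* Multiplication by S v permutes the moduli of the coordinates of x. *)
  have norm_neq0 : \sum_b `|y b| != 0.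
    rewrite psumr_neq0 //; apply/hasP; exists b0; first exact: mem_index_enum.
    by rewrite normr_gt0.
  apply: (mulIf norm_neq0); rewrite mul1r.
  rewrite [in LHS](reindex_inj (addIr v)) mulr_sumr; apply: eq_bigr => b _ /=.
  by rewrite -normrM -lamE normrM c_norm mulr1.
(* Both sides are compared on the nonzero coordinate b0 = w + u + v. *)
apply: (mulIf yb0); rewrite -[b0](subrK (u + v)); set w := b0 - _.
rewrite -[RHS]mulrA -lamE [lam u * _]mulrC -mulrA addrA.
rewrite mulrA [lam v * _]mulrC -mulrA -lamE mulrA -lamE -mulrA c_coc.
by rewrite mulrCA.
Qed.

(** * Lifting symplectic maps to the Clifford group *)

Section PhaseSpace.
Variables (R : realType) (A : finZmodType).
Local Notation V := (phase_space R A).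

(** A phase for T is a cochain whose coboundary is the ratio
    beta(Tu, Tv) / beta(u, v), which is bimultiplicative, hence a cocycle, and
    symmetric because T preserves omega. *)
Lemma cliff_sp_onto (T : sp R A) : exists x : clifford R A, cliff_sp x == T.
Proof.
pose c (u v : V) := beta (T u) (T v) / beta u v.
have c_norm u v : `|c u v| = 1 by rewrite normrM normfV !beta_norm divr1.
have c_sym u v : c u v = c v u.
  have /eqP := sp_omega T u v; rewrite /omega eqr_div ?beta_neq0 // => /eqP E.
  by apply/eqP; rewrite /c eqr_div ?beta_neq0 // E mulrC.
have c_coc u v w : c u v * c (u + v) w = c v w * c u (v + w).
  by rewrite /c !spD !betaDl !betaDr; field; rewrite !beta_neq0.
have [lam [lam_norm lamD]] := symmetric_cocycle_splits c_norm c_sym c_coc.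
have lam_neq0 v : lam v != 0 by rewrite -normr_eq0 lam_norm oner_eq0.
have phaseP : clifford_pair (sp_perm T, [ffun v => (lam v)^-1]).
  apply/andP; split; first exact/perm_additiveP/spD.
  apply/clifford_phaseP; split=> [v|v w]; rewrite !ffunE.
    by rewrite normfV lam_norm invr1.
  rewrite -/(c v w) -invfM lamD invfM mulrC mulVKf //.
  by rewrite mulf_neq0 ?invr_eq0 ?beta_neq0.
by exists (Clifford phaseP); apply/eqP/val_inj.
Qed.

Definition cliff_lift (T : sp R A) : clifford R A := xchoose (cliff_sp_onto T).

Lemma cliff_liftK : cancel cliff_lift (@cliff_sp R A).
Proof. by move=> T; apply/eqP/(xchooseP (cliff_sp_onto T)). Qed.

(** * The canonical extension and the factor sets *)

Section Inertia.
Variable u : V.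

Lemma D_C_inertia : D_C R A \subset inertia u.
Proof. by apply/subsetP => _ /imsetP[mu _ ->]; rewrite inE cliff_perm1. Qed.

Lemma chi_hat_coboundary (alpha : sp R A -> sp R A -> R[i]) :
  associated_factor_set u alpha -> coboundary u alpha.
Proof.
move=> [r [c [_ rP rM alphaE]]].
exists (chi_hat u \o r); split=> [T /rP[rT _]|S T uS uT].
  exact: (chi_hat_linear_char u).1.
have [[rS _] [rT _]] := (rP S uS, rP T uT).
have [rST _] := rP _ (groupM uS uT).
rewrite /= -(chi_hat_linear_char u).2 // rM // alphaE //.
by rewrite (chi_hat_linear_char u).2 // (subsetP D_C_inertia) // imset_f.
Qed.

(** * Phases at the source of u *)

(** The only weight that the value at (T, 0) of an element of Pi can see. *)
Definition source (T : sp R A) : V := (T^-1)%g u.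

Lemma sourceK (T : sp R A) : T (source T) = u.
Proof. by rewrite /source -spME mulgV sp1E. Qed.

Lemma source_uniq (T : sp R A) v : T v = u -> v = source T.
Proof. by rewrite /source => <-; rewrite -spME mulVg sp1E. Qed.

Lemma source_stab (S T : sp R A) : S \in sp_stab u -> source (S * T)%g = source T.
Proof. by rewrite inE => /eqP Su; apply/esym/source_uniq; rewrite spME sourceK. Qed.

Definition source_phase (x : clifford R A) : R[i] :=
  cliff_phase x (source (cliff_sp x)).

Lemma source_phase_neq0 x : source_phase x != 0.
Proof. exact: cliff_phase_neq0. Qed.

(** Left multiplication by the inertia group changes the source phase by chi_hat,
    just as it changes the functions in the induced representation of C(A). *)
Lemma source_phaseM h x : h \in inertia u ->
  source_phase (h * x)%g = chi_hat u h * source_phase x.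
Proof.
move=> uh; rewrite /source_phase cliff_spM (source_stab _ (cliff_sp_stab uh)).
by rewrite cliff_phaseM -cliff_spE sourceK.
Qed.

(** * The two induced spaces *)

Variables (W : vectType R[i]) (sigma : linrep (sp_stab u) W).
Local Notation indAsp := (subvs_of (ind_space (asp_sigma sigma))).
Local Notation indC := (subvs_of (ind_space (chi_hat_tensor sigma))).

Lemma Pi_stab (f : indAsp) h x : h \in asp_stab u ->
  vsval f (h * x)%g = asp_char h u *: sigma (asp_sp h) (vsval f x).
Proof.
move=> uh; have /ind_spaceP -> // := subvsP f.
by rewrite /= scale_lfunE.
Qed.

Lemma ind_inertia (F : indC) h x : h \in inertia u ->
  vsval F (h * x)%g = chi_hat u h *: sigma (cliff_sp h) (vsval F x).
Proof.
move=> uh; have /ind_spaceP -> // := subvsP F.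
by rewrite /= scale_lfunE.
Qed.

Lemma sigma1 w : sigma 1%g w = w.
Proof. by have [-> _] := linrepP sigma; rewrite id_lfunE. Qed.

(** (T, chi) is the product of (id, chi \o T^-1), which lies in the stabiliser,
    and (T, 0). *)
Lemma Pi_char (f : indAsp) T chi :
  vsval f (Asp T chi) = chi (source T) *: vsval f (Asp T 0).
Proof.
pose h : asp R A := Asp 1%g (dual_pull chi T^-1%g).
have -> : Asp T chi = (h * Asp T 0)%g.
  rewrite aspM mul1g addr0; congr Asp; apply: dualP => v.
  by rewrite !dual_pullE -spME mulVg sp1E.
by rewrite Pi_stab ?inE ?sp1E // sigma1 dual_pullE.
Qed.

(** By Pi_char, right translation by (id, chi) multiplies the value at (T, 0) by
    chi (source T), while it acts on weight v by chi v; characters separate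
    points. *)
Lemma Pi_weight_eval (f : indAsp) v T :
  f \in weight_space (Pi sigma) v -> v != source T -> vsval f (Asp T 0) = 0.
Proof.
move=> /weight_spaceP f_v; apply: contraNeq => fT.
apply/eqP/(@dual_inj_eval R) => chi; apply/eqP.
have := congr1 (fun g : indAsp => vsval g (Asp T 0)) (f_v chi).
rewrite indE aspM mulg1 dual_pull0 add0r Pi_char /= => /eqP.
rewrite ffunE -subr_eq0 -scalerBl scaler_eq0 (negPf fT) orbF subr_eq0.
by rewrite eq_sym.
Qed.

(** The action of x is a sum over the weights, and evaluation keeps only the term
    of weight source (cliff_sp x), where the phase of x is source_phase x. *)
Lemma Pi_tilde_eval1 (f : indAsp) x :
  vsval (Pi_tilde sigma x f) 1%g = source_phase x *: vsval f (Asp (cliff_sp x) 0).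
Proof.
have fE : \sum_v weight_proj (Pi sigma) v f = f.
  by apply: sumv_pi_sum; rewrite weight_space_total memvf.
rewrite -[in RHS]fE !linear_sum /= /functor_act sum_lfunE linear_sum !sum_ffunE.
rewrite scaler_sumr; apply: eq_bigr => v _.
set g := weight_proj _ _ _.
have g_v : g \in weight_space (Pi sigma) v by apply: memv_sum_pi.
rewrite scale_lfunE comp_lfunE -/g linearZ ffunE /= indE mul1g.
have [-> //|vx] := eqVneq v (source (cliff_sp x)).
by rewrite (Pi_weight_eval g_v vx) !scaler0.
Qed.

(** * The intertwiner *)

Definition intertwiner_fun (f : indAsp) : {ffun clifford R A -> W} :=
  [ffun x => source_phase x *: vsval f (Asp (cliff_sp x) 0)].

Fact intertwiner_mem f : intertwiner_fun f \in ind_space (chi_hat_tensor sigma).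
Proof.
apply/ind_spaceP => h uh x; have uhsp := cliff_sp_stab uh.
rewrite !ffunE /= scale_lfunE linearZ /= source_phaseM // cliff_spM.
have -> : Asp (cliff_sp h * cliff_sp x)%g 0 =
          (Asp (cliff_sp h) 0 * Asp (cliff_sp x) 0)%g.
  by rewrite aspM dual_pull0 addr0.
rewrite Pi_stab; last by rewrite inE.
by rewrite dual_zeroE scale1r scalerA.
Qed.

Definition intertwiner f : indC := Subvs (intertwiner_mem f).

Fact intertwiner_linear : linear intertwiner.
Proof.
move=> a f g; apply/val_inj/ffunP=> x; rewrite /= !ffunE /=.
rewrite scalerDr; congr (_ + _).
by rewrite !scalerA; congr (_ *: _); exact: mulrC.
Qed.
HB.instance Definition _ :=
  GRing.isLinear.Build R[i] indAsp indC _ intertwiner intertwiner_linear.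

(** The form dictated by Frobenius reciprocity, from which equivariance is
    immediate. *)
Lemma intertwinerE f x :
  vsval (intertwiner f) x = vsval (Pi_tilde sigma x f) 1%g.
Proof. by rewrite Pi_tilde_eval1 ffunE. Qed.

Lemma Pi_tildeM x y f :
  Pi_tilde sigma (x * y)%g f = Pi_tilde sigma x (Pi_tilde sigma y f).
Proof. by have [_ ->] := linrepP (Pi_tilde sigma); rewrite ?inE // comp_lfunE. Qed.

Lemma intertwiner_equivariant x f :
  intertwiner (Pi_tilde sigma x f) = ind (chi_hat_tensor sigma) x (intertwiner f).
Proof.
by apply/val_inj/ffunP => y; rewrite indE !intertwinerE Pi_tildeM.
Qed.

Lemma intertwiner_inj : injective intertwiner.
Proof.
move=> f g fg; apply/val_inj/ffunP => -[T chi].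
rewrite (Pi_char f) (Pi_char g); congr (_ *: _).
have := congr1 (fun F : indC => vsval F (cliff_lift T)) fg.
rewrite /= !ffunE cliff_liftK.
by move/(scalerI (source_phase_neq0 _)).
Qed.

(** Dividing by the source phase removes the character chi_hat from the
    equivariance of an induced function, so that only sigma is left. In particular
    the result depends on x through cliff_sp x alone. *)
Lemma unphase_stab (F : indC) x y :
  (cliff_sp y * (cliff_sp x)^-1)%g \in sp_stab u ->
  (source_phase y)^-1 *: vsval F y =
  (source_phase x)^-1 *: sigma (cliff_sp y * (cliff_sp x)^-1)%g (vsval F x).
Proof.
have -> : (cliff_sp y * (cliff_sp x)^-1 = cliff_sp (y * x^-1))%g.
  by apply: (canLR (mulgK _)); rewrite -cliff_spM mulgKV.
set h := (y * x^-1)%g => uh; have {}uh : h \in inertia u by move: uh; rewrite !inE.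
have hn0 : chi_hat u h != 0 by apply: cliff_phase_neq0.
have -> : y = (h * x)%g by rewrite mulgKV.
rewrite source_phaseM // ind_inertia // scalerA invfM mulrC mulrA.
by rewrite divff // mul1r.
Qed.

(** The inverse is forced: Pi_char gives the dependence on the second component,
    and the value at (T, 0) is read off at a lift of T. *)
Definition intertwiner_inv_fun (F : indC) : {ffun asp R A -> W} :=
  [ffun x => (asp_char x (source (asp_sp x)) / source_phase (cliff_lift (asp_sp x)))
               *: vsval F (cliff_lift (asp_sp x))].

Fact intertwiner_inv_mem F : intertwiner_inv_fun F \in ind_space (asp_sigma sigma).
Proof.
apply/ind_spaceP => h uh x; have uhsp := asp_sp_stab uh.
rewrite !ffunE /= scale_lfunE linearZ /= source_stab // sourceK.
rewrite -2!scalerA.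
rewrite (@unphase_stab F (cliff_lift (asp_sp x))) !cliff_liftK mulgK //.
by rewrite !scalerA !mulrA.
Qed.

Lemma intertwiner_surj F : exists f, intertwiner f = F.
Proof.
exists (Subvs (intertwiner_inv_mem F)); apply/val_inj/ffunP => x /=.
rewrite !ffunE /= mul1r.
rewrite (@unphase_stab F x) ?cliff_liftK ?mulgV ?group1 // sigma1.
by rewrite scalerA divff ?source_phase_neq0 // scale1r.
Qed.

Theorem Pi_tilde_iso : linrep_iso (Pi_tilde sigma) (ind (chi_hat_tensor sigma)).
Proof.
exists (linfun intertwiner); split=> [||x _].
- by apply/eqP/lker0P => f g; rewrite !lfunE; apply: intertwiner_inj.
- apply/eqP; rewrite eqEsubv subvf; apply/subvP => F _.
  have [f <-] := intertwiner_surj F.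
  by rewrite -[intertwiner f]lfunE memv_img ?memvf.
- apply/lfunP => f; rewrite !comp_lfunE ![linfun intertwiner _]lfunE.
  exact: intertwiner_equivariant.
Qed.

End Inertia.
End PhaseSpace.

Theorem theorem4p2 (R : realType) (A : finZmodType) (u : phase_space R A) :
  [/\ [/\ D_C R A \subset inertia u,
          linear_char (inertia u) (chi_hat u)
        & forall mu : dual R (phase_space R A),
            chi_hat u (cliff_dual mu) = chi_u u mu],
      forall alpha : sp R A -> sp R A -> R[i],
        associated_factor_set u alpha -> coboundary u alpha
    & forall (W : vectType R[i]) (sigma : linrep (sp_stab u) W),
        linrep_irreducible sigma ->
        linrep_iso (Pi_tilde sigma) (ind (chi_hat_tensor sigma))].
Proof.
split; last by move=> W sigma _; apply: Pi_tilde_iso.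
  by split=> //; [apply: D_C_inertia | apply: chi_hat_linear_char].
by move=> alpha; apply: chi_hat_coboundary.
Qed.
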